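(* Assume that $(g^1_\nu)'(\omega)>0$ for all $\omega\in(0,1)$ and all $\nu\in(0,1)$, where $g^1_\nu$ is the function defined in the context and the prime denotes the derivative with respect to $\omega$. Let $\nu\in(0,1)$. Then: (a) if $\frac14<\nu<1$, the function $g^1_\nu$ has exactly one root $\omega_{opt}$ in $(0,1)$, and the parameter $\omega\in(0,2)$ which minimizes $\|T_\nu(\omega)\|_2$ over $(0,2)$ is $\omega^*_{opt}=\omega_{opt}$; (b) if $0<\nu\le\frac14$, the parameter $\omega\in(0,2)$ which minimizes $\|T_\nu(\omega)\|_2$ over $(0,2)$ is $\omega^*_{opt}=1$.
   Context: $\|\cdot\|_2$ is the spectral norm, and $$T_\nu(\omega)=\begin{pmatrix}|1-\omega| & \omega^2\nu\\ |1-\omega| & |1-\omega|+\omega^2\nu\end{pmatrix}.$$ For $\nu\in(0,1)$ and $\omega\in(0,1)$, $$g^1_\nu(\omega)=s_\nu(\omega)+\frac{r_\nu(\omega)s_\nu(\omega)-8(\omega-1)^3}{\sqrt{[r_\nu(\omega)]^2-4(\omega-1)^4}},$$ where $$r_\nu(\omega)=3(\omega-1)^2+2\nu^2\omega^4+2\nu\omega^2(1-\omega),\qquad s_\nu(\omega)=6(\omega-1)+8\nu^2\omega^3+2\nu(2\omega-3\omega^2).$$ The function $g^1_\nu$ is the derivative on $(0,1)$ of $g_\nu(\omega)=2\|T_\nu(\omega)\|_2^2$. *)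

(* Defs.v *)
From HB Require Import structures.
From mathcomp Require Import all_boot all_order all_algebra.
From mathcomp Require Import all_classical all_reals all_analysis.
Set Implicit Arguments.
Unset Strict Implicit.
Unset Printing Implicit Defensive.
Import Order.TTheory GRing.Theory Num.Theory.
Import numFieldNormedType.Exports.
Local Open Scope classical_set_scope.
Local Open Scope ring_scope.

(* The canonical norm on matrices is the max norm, hence this definition. *)
Definition eucl_norm (R : realType) (n : nat) (x : 'cV[R]_n) : R :=
  Num.sqrt (\sum_(i < n) x i 0 ^+ 2).

(* Spectral norm, as the operator norm induced by the Euclidean norms. *)
Definition spectral_norm (R : realType) (m n : nat) (A : 'M[R]_(m, n)) : R :=
  sup [set eucl_norm (A *m x) | x in [set x : 'cV[R]_n | eucl_norm x = 1]].

Definition T_nu (R : realType) (nu omega : R) : 'M[R]_2 :=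
  \matrix_(i < 2, j < 2)
    if i == 0 then
      (if j == 0 then `|1 - omega| else omega ^+ 2 * nu)
    else
      (if j == 0 then `|1 - omega| else `|1 - omega| + omega ^+ 2 * nu).

Definition r_nu (R : realType) (nu omega : R) : R :=
  3 * (omega - 1) ^+ 2 + 2 * nu ^+ 2 * omega ^+ 4
  + 2 * nu * omega ^+ 2 * (1 - omega).

Definition s_nu (R : realType) (nu omega : R) : R :=
  6 * (omega - 1) + 8 * nu ^+ 2 * omega ^+ 3
  + 2 * nu * (2 * omega - 3 * omega ^+ 2).

(* Meant for nu and omega in ]0, 1[, where the radicand is positive. *)
Definition g1 (R : realType) (nu omega : R) : R :=
  s_nu nu omega
  + (r_nu nu omega * s_nu nu omega - 8 * (omega - 1) ^+ 3)
    / Num.sqrt (r_nu nu omega ^+ 2 - 4 * (omega - 1) ^+ 4).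

(* The set of all minimizers of f over D; [argmin D f = [set x]] says that x
   is the unique minimizer. *)
Definition argmin (R : realType) (D : set R) (f : R -> R) : set R :=
  [set x | D x /\ forall y, D y -> f x <= f y].

(* Main.v *)
Require Import Defs.
From HB Require Import structures.
From mathcomp Require Import all_boot all_order all_algebra.
From mathcomp Require Import all_classical all_reals all_analysis.
From mathcomp Require Import ring lra.
Set Implicit Arguments.
Unset Strict Implicit.
Unset Printing Implicit Defensive.
Import Order.TTheory GRing.Theory Num.Theory.
Import numFieldNormedType.Exports.
Local Open Scope classical_set_scope.
Local Open Scope ring_scope.

(** For a real 2x2 matrix A with squared Frobenius norm F, the characteristic
    equation of A^T A is l^2 - F l + (det A)^2 = 0, so the square of the
    spectral norm is its larger root (spectral_norm2).  For T_nu(w) with w <= 1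
    one has F = r_nu(w) and det = (1 - w)^2, which gives
    2 ||T_nu(w)||^2 = g(w) := r + sqrt (r^2 - 4 (w - 1)^4).

    On [0, 1] the radicand is positive, so g is differentiable there, with
    derivative g1 (is_derive_g), and g1 is itself differentiable; the assumption
    on its derivative makes g1 strictly increasing on the closed interval.  At
    the end points g1(0) < 0 and g1(1) = 4 nu (4 nu - 1).  If nu > 1/4, then g1
    changes sign at exactly one point of (0, 1); if nu <= 1/4, then g1 is
    negative on (0, 1).  In both cases there is a point m of (0, 1] (m = 1 in
    the second case) such that g strictly decreases before m and strictly
    increases between m and 1.

    For w > 1 the image of the second basis vector alone is longer than
    ||T_nu(1)||, so no minimizer lies in (1, 2).  Hence m is the unique
    minimizer on (0, 2) (argmin_T). *)

(** * Minimizers and attained suprema *)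

Lemma argmin_unique (R : realType) (D : set R) (f : R -> R) (x : R) :
  D x -> (forall y, D y -> y != x -> f x < f y) -> argmin D f = [set x].
Proof.
move=> Dx fx; apply/seteqP; split => [y [Dy fy]|_ ->]; last first.
  split=> // y Dy; have [->//|yx] := eqVneq y x; exact/ltW/fx.
by apply/eqP; apply/negPn/negP => /(fx _ Dy); rewrite ltNge fy.
Qed.

Lemma spectral_norm_attained (R : realType) (m n : nat) (A : 'M[R]_(m, n))
    (x : 'cV[R]_n) :
  eucl_norm x = 1 ->
  (forall y, eucl_norm y = 1 -> eucl_norm (A *m y) <= eucl_norm (A *m x)) ->
  spectral_norm A = eucl_norm (A *m x).
Proof.
move=> x1 Ax; have Sx : [set eucl_norm (A *m x) | x in
    [set x : 'cV[R]_n | eucl_norm x = 1]] (eucl_norm (A *m x)) by exists x.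
have ubAx : ubound [set eucl_norm (A *m x) | x in
    [set x : 'cV[R]_n | eucl_norm x = 1]] (eucl_norm (A *m x)).
  by move=> _ [y /= y1 <-]; exact: Ax.
apply/eqP; rewrite eq_le; apply/andP; split.
  by apply: ge_sup ubAx; exists (eucl_norm (A *m x)).
by apply: ub_le_sup Sx; exists (eucl_norm (A *m x)).
Qed.

(** * The spectral norm of a 2x2 matrix *)

(** A binary quadratic form of zero discriminant is a square up to the factor
    P, or reduces to S y^2 when P = 0. *)
Lemma psd_form_ge0 (R : realFieldType) (P S K x y : R) :
  0 <= P -> 0 <= S -> P * S = K ^+ 2 ->
  0 <= P * x ^+ 2 + S * y ^+ 2 - 2 * K * x * y.
Proof.
move=> P0 S0 PS; have [P00|Pn0] := eqVneq P 0.
  have -> : K = 0 by apply/eqP; rewrite -sqrf_eq0 -PS P00 mul0r.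
  by rewrite P00 mul0r add0r mulr0 !mul0r subr0 mulr_ge0// sqr_ge0.
have Pp : 0 < P by rewrite lt_def Pn0.
rewrite -(pmulr_rge0 _ Pp).
have -> : P * (P * x ^+ 2 + S * y ^+ 2 - 2 * K * x * y) = (P * x - K * y) ^+ 2.
  transitivity (P ^+ 2 * x ^+ 2 + P * S * y ^+ 2 - 2 * K * P * x * y).
    by ring.
  by rewrite PS; ring.
exact: sqr_ge0.
Qed.

(** The kernel vector is (K, P), unless P = 0, where K = 0 as well and
    (1, 0) is in the kernel. *)
Lemma psd_form_kernel (R : realFieldType) (P S K : R) :
  P * S = K ^+ 2 ->
  exists x y : R, 0 < x ^+ 2 + y ^+ 2 /\
    P * x ^+ 2 + S * y ^+ 2 - 2 * K * x * y = 0.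
Proof.
move=> PS; have [P0|Pn0] := eqVneq P 0.
  exists 1, 0; split; first by rewrite expr1n expr0n addr0.
  by rewrite P0 expr0n/= !mulr0 mul0r addr0 subr0.
exists K, P; split.
  by rewrite ltr_wpDl ?sqr_ge0// lt_def sqrf_eq0 Pn0 sqr_ge0.
have -> : S * P ^+ 2 = P * K ^+ 2 by rewrite -PS; ring.
by ring.
Qed.

Definition frob_sq (R : realType) (A : 'M[R]_2) : R :=
  A 0 0 ^+ 2 + A 0 1 ^+ 2 + A 1 0 ^+ 2 + A 1 1 ^+ 2.

(** The larger root of the characteristic polynomial of A^T A. *)
Definition gram_max_eig (R : realType) (A : 'M[R]_2) : R :=
  (frob_sq A + Num.sqrt (frob_sq A ^+ 2 - 4 * (\det A) ^+ 2)) / 2.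

Lemma eucl_norm_cV2 (R : realType) (x : 'cV[R]_2) :
  eucl_norm x = Num.sqrt (x 0 0 ^+ 2 + x 1 0 ^+ 2).
Proof.
rewrite /eucl_norm !big_ord_recl big_ord0 addr0.
by congr (Num.sqrt (_ + x _ _ ^+ 2)); apply/val_inj.
Qed.

Lemma mulmx2E (R : realType) (A : 'M[R]_2) (x : 'cV[R]_2) i :
  (A *m x) i 0 = A i 0 * x 0 0 + A i 1 * x 1 0.
Proof.
rewrite mxE !big_ord_recl big_ord0 addr0.
by congr (_ + A _ _ * x _ _); apply/val_inj.
Qed.

Lemma det_mx22 (R : comPzRingType) (A : 'M[R]_2) :
  \det A = A 0 0 * A 1 1 - A 0 1 * A 1 0.
Proof.
rewrite (expand_det_row _ 0) !big_ord_recl big_ord0 addr0 /cofactor !det_mx11.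
rewrite !mxE /= expr0 mul1r expr1 mulN1r mulrN.
by congr (_ * A _ _ - A _ _ * A _ _); apply/val_inj.
Qed.

(** The discriminant of the characteristic polynomial of the Gram matrix. *)
Lemma discr2_ge0 (R : realType) (a b c d : R) :
  0 <= (a ^+ 2 + b ^+ 2 + c ^+ 2 + d ^+ 2) ^+ 2 - 4 * (a * d - b * c) ^+ 2.
Proof.
have -> : (a ^+ 2 + b ^+ 2 + c ^+ 2 + d ^+ 2) ^+ 2 - 4 * (a * d - b * c) ^+ 2
 = ((a - d) ^+ 2 + (b + c) ^+ 2) * ((a + d) ^+ 2 + (b - c) ^+ 2) by ring.
by rewrite mulr_ge0// addr_ge0// sqr_ge0.
Qed.

(** With l the larger eigenvalue of A^T A, the form l |x|^2 - |A x|^2 has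
    coefficients P, S, K with P S = K^2 (l is a root) and P, S >= 0 (l is the
    larger root).  Hence it is nonnegative, so sqrt l bounds |A x| on the unit
    circle, and it vanishes at some nonzero vector, which after normalization
    attains the bound. *)
Lemma spectral_norm2 (R : realType) (A : 'M[R]_2) :
  spectral_norm A = Num.sqrt (gram_max_eig A).
Proof.
set a := A 0 0; set b := A 0 1; set c := A 1 0; set d := A 1 1.
set l := gram_max_eig A.
set F := frob_sq A; set D := F ^+ 2 - 4 * (\det A) ^+ 2.
have FE : F = a ^+ 2 + b ^+ 2 + c ^+ 2 + d ^+ 2 by [].
have dE : \det A = a * d - b * c by rewrite det_mx22.
have D0 : 0 <= D by rewrite /D dE FE; exact: discr2_ge0.
have lE : l = (F + Num.sqrt D) / 2 by [].
set P := l - (a ^+ 2 + c ^+ 2); set S := l - (b ^+ 2 + d ^+ 2).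
set K := a * b + c * d.
have PS : P * S = K ^+ 2.
  have sD : Num.sqrt D ^+ 2 = F ^+ 2 - 4 * (a * d - b * c) ^+ 2.
    by rewrite sqr_sqrtr// /D dE.
  have : l ^+ 2 - F * l + (a * d - b * c) ^+ 2 = 0.
    rewrite lE; transitivity
      ((Num.sqrt D ^+ 2 - (F ^+ 2 - 4 * (a * d - b * c) ^+ 2)) / 4).
      by field.
    by rewrite sD subrr mul0r.
  rewrite FE => e; apply/eqP; rewrite -subr_eq0 -e /P /S /K; apply/eqP; ring.
have PS0 : 0 <= P + S.
  have -> : P + S = Num.sqrt D by rewrite /P /S lE FE; field.
  exact: sqrtr_ge0.
(* A nonnegative product and a nonnegative sum force both signs. *)
have [P0 S0] : 0 <= P /\ 0 <= S.
  have PS0' : 0 <= P * S by rewrite PS sqr_ge0.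
  by split; nra.
have norm2 (x : 'cV[R]_2) : eucl_norm (A *m x) =
   Num.sqrt (l * (x 0 0 ^+ 2 + x 1 0 ^+ 2) -
     (P * x 0 0 ^+ 2 + S * x 1 0 ^+ 2 - 2 * K * x 0 0 * x 1 0)).
  rewrite eucl_norm_cV2 !mulmx2E; congr Num.sqrt.
  by rewrite -/a -/b -/c -/d /P /S /K; ring.
have norm1 (x : 'cV[R]_2) : eucl_norm x = 1 -> x 0 0 ^+ 2 + x 1 0 ^+ 2 = 1.
  rewrite eucl_norm_cV2 => x1.
  by rewrite -[LHS]sqr_sqrtr ?addr_ge0 ?sqr_ge0// x1 expr1n.
have [u [v [uv0 uvK]]] := psd_form_kernel PS.
set n := Num.sqrt (u ^+ 2 + v ^+ 2).
have n2 : n ^+ 2 = u ^+ 2 + v ^+ 2 by rewrite sqr_sqrtr ?ltW.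
have n0 : n != 0 by rewrite sqrtr_eq0 -ltNge.
pose x : 'cV[R]_2 := \col_i (if i == 0 then u / n else v / n).
have x0 : x 0 0 = u / n by rewrite mxE.
have x1 : x 1 0 = v / n by rewrite mxE.
have nx : x 0 0 ^+ 2 + x 1 0 ^+ 2 = 1.
  by rewrite x0 x1 !expr_div_n -mulrDl -n2 divff// expf_neq0.
have Ax : eucl_norm (A *m x) = Num.sqrt l.
  rewrite norm2 nx mulr1 x0 x1; congr Num.sqrt.
  suff -> : P * (u / n) ^+ 2 + S * (v / n) ^+ 2 - 2 * K * (u / n) * (v / n) = 0
    by rewrite subr0.
  transitivity ((P * u ^+ 2 + S * v ^+ 2 - 2 * K * u * v) / n ^+ 2).
    by field.
  by rewrite uvK mul0r.
rewrite (spectral_norm_attained (x := x)) ?Ax//.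
  by rewrite eucl_norm_cV2 nx sqrtr1.
move=> y /norm1 y1; rewrite norm2 y1 mulr1 ler_wsqrtr// gerBl.
exact: psd_form_ge0.
Qed.

(** The second column is the image of a unit vector, so its squared length is at
    most the squared spectral norm. *)
Lemma gram_max_eig_ge_col1 (R : realType) (A : 'M[R]_2) :
  A 0 1 ^+ 2 + A 1 1 ^+ 2 <= gram_max_eig A.
Proof.
rewrite /gram_max_eig det_mx22 /frob_sq ler_pdivlMr//.
set a := A 0 0; set b := A 0 1; set c := A 1 0; set d := A 1 1.
rewrite -lerBlDl; apply: (le_trans (ler_norm _)).
rewrite -sqrtr_sqr ler_wsqrtr// -subr_ge0.
have -> : (a ^+ 2 + b ^+ 2 + c ^+ 2 + d ^+ 2) ^+ 2 - 4 * (a * d - b * c) ^+ 2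
  - ((b ^+ 2 + d ^+ 2) * 2 - (a ^+ 2 + b ^+ 2 + c ^+ 2 + d ^+ 2)) ^+ 2
  = (2 * (a * b + c * d)) ^+ 2 by ring.
exact: sqr_ge0.
Qed.

(** * The function g and its derivative *)

Definition g_discr (R : realType) (nu w : R) : R :=
  r_nu nu w ^+ 2 - 4 * (w - 1) ^+ 4.
(** Twice the squared spectral norm of T_nu(w), valid for w <= 1. *)
Definition g (R : realType) (nu w : R) : R :=
  r_nu nu w + Num.sqrt (g_discr nu w).

(** The functions r_nu and g_discr are evaluations of polynomials, which reduces
    their derivatives to formal ones. *)
Definition r_poly (R : realType) (nu : R) : {poly R} :=
  3 *: ('X - 1) ^+ 2 + (2 * nu ^+ 2) *: 'X^4 + (2 * nu) *: ('X^2 * (1 - 'X)).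
Definition discr_poly (R : realType) (nu : R) : {poly R} :=
  r_poly nu ^+ 2 - 4 *: ('X - 1) ^+ 4.

Lemma r_polyE (R : realType) (nu : R) : r_nu nu = horner (r_poly nu).
Proof. by apply/funext => w; rewrite /r_poly /r_nu !hornerE /=; ring. Qed.

Lemma r_poly_deriv (R : realType) (nu w : R) : (r_poly nu)^`().[w] = s_nu nu w.
Proof. by rewrite /r_poly /s_nu !poly.derivE !hornerE /=; ring. Qed.

Lemma discr_polyE (R : realType) (nu : R) : g_discr nu = horner (discr_poly nu).
Proof. by apply/funext => w; rewrite /g_discr r_polyE /discr_poly !hornerE. Qed.

Lemma discr_poly_deriv (R : realType) (nu w : R) : (discr_poly nu)^`().[w] =
  2 * (r_nu nu w * s_nu nu w - 8 * (w - 1) ^+ 3).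
Proof.
rewrite -r_poly_deriv r_polyE /discr_poly; move: (r_poly nu) => p.
by rewrite !poly.derivE !hornerE /=; ring.
Qed.

Lemma is_derive_sqrt_discr (R : realType) (nu w : R) : 0 < g_discr nu w ->
  is_derive w 1 (fun x => Num.sqrt (g_discr nu x))
   ((r_nu nu w * s_nu nu w - 8 * (w - 1) ^+ 3) / Num.sqrt (g_discr nu w)).
Proof.
move=> D0; have hD : is_derive w 1 (g_discr nu) (discr_poly nu)^`().[w].
  by rewrite discr_polyE; exact: is_derive_poly.
have := is_derive1_comp (is_derive1_sqrt D0) hD.
rewrite discr_poly_deriv; congr is_derive.
by field; rewrite sqrtr_eq0 -ltNge.
Qed.

Lemma is_derive_g (R : realType) (nu w : R) : 0 < g_discr nu w ->
  is_derive w 1 (g nu) (g1 nu w).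
Proof.
move=> D0; apply: is_deriveD; last exact: is_derive_sqrt_discr.
by rewrite r_polyE -r_poly_deriv; exact: is_derive_poly.
Qed.

Lemma derivable_g1 (R : realType) (nu w : R) : 0 < g_discr nu w ->
  derivable (g1 nu) w 1.
Proof.
move=> D0.
have dr : derivable (r_nu nu) w 1 by rewrite r_polyE; exact: derivable_horner.
have ds : derivable (s_nu nu) w 1.
  have -> : s_nu nu = horner (r_poly nu)^`().
    by apply/funext => x; rewrite r_poly_deriv.
  exact: derivable_horner.
have dc : derivable (fun x : R => 8 * (x - 1) ^+ 3) w 1.
  have -> : (fun x : R => 8 * (x - 1) ^+ 3) = horner (8 *: ('X - 1) ^+ 3).
    by apply/funext => x; rewrite !hornerE.
  exact: derivable_horner.
have dN := derivableB (derivableM dr ds) dc.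
have dV : derivable (fun x => (Num.sqrt (g_discr nu x))^-1) w 1.
  apply: derivableV; first by rewrite sqrtr_eq0 -ltNge.
  by case: (is_derive_sqrt_discr D0).
exact: (derivableD ds (derivableM dN dV)).
Qed.

(** With a = 1 - w and b = nu w^2 the radicand factors as
    (r - 2 a^2) (r + 2 a^2); both factors are at least a^2 + b^2, and a, b
    do not vanish together. *)
Lemma g_discr_gt0 (R : realType) (nu w : R) : 0 < nu -> 0 <= w <= 1 ->
  0 < g_discr nu w.
Proof.
move=> nu0 /andP[w0 w1].
have -> : g_discr nu w =
    ((1 - w) ^+ 2 + 2 * (nu * w ^+ 2) ^+ 2 + 2 * (nu * w ^+ 2) * (1 - w)) *
    (5 * (1 - w) ^+ 2 + 2 * (nu * w ^+ 2) ^+ 2 + 2 * (nu * w ^+ 2) * (1 - w)).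
  by rewrite /g_discr /r_nu; ring.
have b0 : 0 <= nu * w ^+ 2 by rewrite mulr_ge0 ?sqr_ge0// ltW.
have ab0 : 0 <= nu * w ^+ 2 * (1 - w) by rewrite mulr_ge0// subr_ge0.
have ab1 : 0 < (1 - w) ^+ 2 + (nu * w ^+ 2) ^+ 2.
  have [->|wn1] := eqVneq w 1.
    by rewrite subrr expr0n add0r expr1n mulr1 exprn_gt0.
  by rewrite ltr_wpDr ?sqr_ge0// exprn_even_gt0//= subr_eq0 eq_sym.
have a2 := sqr_ge0 (1 - w); have b2 := sqr_ge0 (nu * w ^+ 2).
by apply: mulr_gt0; lra.
Qed.

Lemma g1_0_lt0 (R : realType) (nu : R) : g1 nu 0 < 0.
Proof.
rewrite /g1 /r_nu /s_nu.
set N := (X in X / _); set q := Num.sqrt _.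
have -> : N = - 10 by rewrite /N; ring.
have : 0 <= 10 / q by rewrite divr_ge0// sqrtr_ge0.
by rewrite mulNr expr0n /= expr0n /=; nra.
Qed.

Lemma g1_1 (R : realType) (nu : R) : 0 < nu -> g1 nu 1 = 4 * nu * (4 * nu - 1).
Proof.
move=> nu0; rewrite /g1 /r_nu /s_nu subrr.
have -> : (3 * 0 ^+ 2 + 2 * nu ^+ 2 * 1 ^+ 4 + 2 * nu * 1 ^+ 2 * 0) ^+ 2 -
    4 * 0 ^+ 4 = (2 * nu ^+ 2) ^+ 2 by ring.
rewrite sqrtr_sqr ger0_norm; last by rewrite mulr_ge0// sqr_ge0.
by field; rewrite gt_eqF.
Qed.

(** * Comparing the norms of T_nu *)

Lemma gram_max_eig_T_le1 (R : realType) (nu w : R) : w <= 1 ->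
  gram_max_eig (T_nu nu w) = g nu w / 2.
Proof.
move=> w1; rewrite /gram_max_eig /frob_sq det_mx22 !mxE /=.
rewrite ger0_norm ?subr_ge0//.
congr (_ / 2); rewrite /g /g_discr /r_nu; congr (_ + Num.sqrt _); ring.
Qed.

Lemma gram_max_eig_T_gt0 (R : realType) (nu w : R) : 0 < nu -> 0 < w ->
  0 < gram_max_eig (T_nu nu w).
Proof.
move=> nu0 w0; apply: lt_le_trans (gram_max_eig_ge_col1 _); rewrite !mxE /=.
by rewrite ltr_pwDl ?sqr_ge0// exprn_gt0// mulr_gt0// exprn_gt0.
Qed.

(** At w = 1 the squared norm is 2 nu^2, while for w > 1 the second column has
    entries w^2 nu and (w - 1) + w^2 nu, both larger than nu. *)
Lemma gram_max_eig_T_gt1 (R : realType) (nu w : R) : 0 < nu -> 1 < w ->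
  gram_max_eig (T_nu nu 1) < gram_max_eig (T_nu nu w).
Proof.
move=> nu0 w1; apply: lt_le_trans (gram_max_eig_ge_col1 _).
rewrite gram_max_eig_T_le1// /g /g_discr.
have -> : r_nu nu 1 = 2 * nu ^+ 2 by rewrite /r_nu; ring.
rewrite subrr expr0n mulr0 subr0 sqrtr_sqr ger0_norm; last first.
  by rewrite mulr_ge0// sqr_ge0.
have -> : (2 * nu ^+ 2 + 2 * nu ^+ 2) / 2 = nu ^+ 2 + nu ^+ 2 by field.
rewrite !mxE /=; have nuw : nu < w ^+ 2 * nu.
  by rewrite ltr_pMl// exprn_egt1.
have w0 : 0 < w ^+ 2 * nu := lt_trans nu0 nuw.
apply: ltrD; rewrite ltr_pXn2r// ?nnegrE ?addr_ge0// ?ltW//.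
by rewrite ltr_wpDl.
Qed.

(** Both parts of the theorem are instances: m is the sign change of g1 if there
    is one in (0, 1), and m = 1 if g1 is negative on all of (0, 1). *)
Lemma argmin_T (R : realType) (nu m : R) : 0 < nu -> 0 < m <= 1 ->
  (forall w : R, 0 < w < m -> g1 nu w < 0) ->
  (forall w : R, m < w < 1 -> 0 < g1 nu w) ->
  argmin [set w | 0 < w < 2] (fun w => spectral_norm (T_nu nu w)) = [set m].
Proof.
move=> nu0 /andP[m0 m1] gdecr gincr.
apply: argmin_unique => [/=|y /= /andP[y0 y2] ym]; first by lra.
rewrite !spectral_norm2 ltr_sqrt ?gram_max_eig_T_gt0//.
have dg (x : R) : 0 < x -> x <= 1 -> is_derive x 1 (g nu) (g1 nu x).
  by move=> x0 x1; apply/is_derive_g/g_discr_gt0; rewrite // ltW.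
have dgE (x : R) : 0 < x -> x <= 1 -> derive1 (g nu) x = g1 nu x.
  by move=> x0 x1; rewrite derive1E; have [_ ->] := dg x x0 x1.
have cg (a b : R) : 0 < a -> b <= 1 -> {within `[a, b], continuous (g nu)}.
  move=> a0 b1; apply: derivable_within_continuous => x.
  rewrite in_itv /= => /andP[ax xb].
  by have [] := dg x (lt_le_trans a0 ax) (le_trans xb b1).
have incr (z : R) : m < z -> z <= 1 -> g nu m < g nu z.
  move=> mz z1; apply: (@gtr0_derive1_lt_cc _ _ m z).
  - move=> x; rewrite in_itv /= => /andP[mx xz].
    by have [] := dg x (lt_trans m0 mx) (ltW (lt_le_trans xz z1)).
  - move=> x; rewrite in_itv /= => /andP[mx xz].
    rewrite dgE ?(lt_trans m0 mx)// ?(ltW (lt_le_trans xz z1))//.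
    by rewrite gincr// mx (lt_le_trans xz).
  - exact: cg.
  - by rewrite in_itv /= lexx ltW.
  - by rewrite in_itv /= lexx ltW.
  - exact: mz.
(* Beyond 1 the value g 1 separates y from m. *)
have [y1|y1] := leP y 1; last first.
  apply: le_lt_trans (gram_max_eig_T_gt1 nu0 y1).
  rewrite !gram_max_eig_T_le1// ler_pM2r ?invr_gt0//.
  by move: m1; rewrite le_eqVlt => /predU1P[->//|m1]; exact/ltW/incr.
rewrite !gram_max_eig_T_le1// ltr_pM2r ?invr_gt0//.
case: (ltgtP y m) ym => // [ym|my] _; last exact: incr.
apply: (@ltr0_derive1_lt_cc _ _ y m).
- move=> x; rewrite in_itv /= => /andP[yx xm].
  by have [] := dg x (lt_trans y0 yx) (ltW (lt_le_trans xm m1)).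
- move=> x; rewrite in_itv /= => /andP[yx xm].
  rewrite dgE ?(lt_trans y0 yx)// ?(ltW (lt_le_trans xm m1))//.
  by rewrite gdecr// xm (lt_trans y0).
- exact: cg.
- by rewrite in_itv /= lexx ltW.
- by rewrite in_itv /= lexx ltW.
- exact: ym.
Qed.

(** * The optimal parameter *)

Theorem mainTheorem2 (R : realType)
  (g1_deriv_gt0 : forall omega nu : R,
     0 < omega < 1 -> 0 < nu < 1 -> 0 < derive1 (g1 nu) omega)
  (nu : R) (nu01 : 0 < nu < 1) :
  (1 / 4 < nu < 1 ->
     exists omega_opt : R,
       [set omega | 0 < omega < 1 /\ g1 nu omega = 0] = [set omega_opt] /\
       argmin [set omega | 0 < omega < 2]
         (fun omega => spectral_norm (T_nu nu omega)) = [set omega_opt]) /\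
  (0 < nu <= 1 / 4 ->
     argmin [set omega | 0 < omega < 2]
       (fun omega => spectral_norm (T_nu nu omega)) = [set 1]).
Proof.
have nu0 : 0 < nu by case/andP: nu01.
have dg1 (x : R) : 0 <= x <= 1 -> derivable (g1 nu) x 1.
  by move=> x01; apply/derivable_g1/g_discr_gt0.
have cg1 : {within `[0, 1], continuous (g1 nu)}.
  by apply: derivable_within_continuous => x; rewrite in_itv; exact: dg1.
have g1_incr (x y : R) : 0 <= x -> x < y -> y <= 1 -> g1 nu x < g1 nu y.
  move=> x0 xy y1; apply: (@gtr0_derive1_lt_cc _ _ 0 1).
  - by move=> z; rewrite in_itv /= => /andP[z0 z1]; apply: dg1; rewrite !ltW.
  - by move=> z; rewrite in_itv /= => z01; exact: g1_deriv_gt0.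
  - exact: cg1.
  - by rewrite in_itv /= x0 ltW// (lt_le_trans xy).
  - by rewrite in_itv /= y1 ltW// (le_lt_trans x0).
  - exact: xy.
split=> [/andP[nu4 _]|/andP[_ nu4]]; last first.
  apply: argmin_T => // [|w /andP[w0 w1]|w]; first by rewrite ltr01 lexx.
    apply: lt_le_trans (g1_incr _ _ (ltW w0) w1 (lexx _)) _.
    by rewrite g1_1// mulr_ge0_le0 ?mulr_ge0 ?(ltW nu0)//; lra.
  by move=> /andP[w1 w1']; have := lt_trans w1 w1'; rewrite ltxx.
have g1_1_gt0 : 0 < g1 nu 1 by rewrite g1_1// !mulr_gt0//; lra.
have g1_0_lt0 := g1_0_lt0 nu.
have [|c] := IVT ler01 cg1 (v := 0).
  by rewrite minEle maxEle (ltW (lt_trans g1_0_lt0 g1_1_gt0)) !ltW.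
rewrite in_itv /= => /andP[c0 c1] g1c.
have {}c0 : 0 < c.
  rewrite lt_neqAle c0 andbT; apply/eqP => c_eq.
  by move: g1_0_lt0; rewrite {1}c_eq g1c ltxx.
have {}c1 : c < 1.
  rewrite lt_neqAle c1 andbT; apply/eqP => c_eq.
  by move: g1_1_gt0; rewrite -{1}c_eq g1c ltxx.
have g1_neg (w : R) : 0 < w < c -> g1 nu w < 0.
  by move=> /andP[w0 wc]; rewrite -g1c g1_incr// ltW.
have g1_pos (w : R) : c < w < 1 -> 0 < g1 nu w.
  by move=> /andP[cw w1]; rewrite -g1c g1_incr// ltW.
exists c; split; last by apply: argmin_T => //; rewrite c0 ltW.
apply/seteqP; split=> [w [/andP[w0 w1] g1w]|_ ->]; last by rewrite /= c0 c1.
case: (ltgtP w c) => // h.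
- by have := g1_neg w; rewrite w0 h g1w ltxx => /(_ isT).
- by have := g1_pos w; rewrite w1 h g1w ltxx => /(_ isT).
Qed.
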